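(* Let $n$ be a positive integer, let $m,t$ be positive divisors of $n$ with $n\nmid mt$, let $\zeta\in\Bbbk$ be a primitive $n$-th root of unity, and let $H=H_n(\zeta,m,t)$. Assume $H$-module algebra structures $A(H)$ exist, and fix one such structure on $A=A(H)=\Bbbk[u]/(u^n-1)$, where $u$ is chosen with $y\cdot u=\zeta u$. If the action of $H$ extends to make $A$ a $D(H)$-module algebra, then there exist a nonzero scalar $\gamma\in\Bbbk$, a scalar $\delta\in\Bbbk$, and a natural number $0<d<n$ with $m\equiv -dt \pmod n$ such that $$y\cdot u=\zeta u,\qquad Y\cdot u=\zeta^d u,\qquad x\cdot u=\gamma u^{1+t},\qquad X\cdot u=\delta u^{1-t}.$$ If $m\neq n/2$, then $\gamma$ and $\delta$ are related by $$\gamma\delta=\frac{\zeta^{-m}-1}{(n-t)_{\zeta^m}};$$ in this case the action of $X$ on $A$ is determined by the $H$-module algebra structure, and if further $t=1$, then the action of $Y$ is as well. If $m=n/2$, there is no such equation relating $\gamma$ and $\delta$. Conversely, the conditions imposed above on $\delta$ and $d$ (namely $0<d<n$ with $m\equiv -dt\pmod n$, and, when $m\neq n/2$, the displayed equation for $\gamma\delta$, with $\delta\in\Bbbk$ arbitrary when $m=n/2$) are sufficient for the formulas above to define a $D(H)$-module algebra structure on $A$ extending the given $H$-module algebra structure.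
   Context: $\Bbbk$ is an algebraically closed field of characteristic $0$. For grouplike elements $g,h$, an element $c$ is $(g,h)$-skew primitive if $\Delta(c)=g\otimes c+c\otimes h$. For an integer $k\ge 0$, $(k)_q=1+q+\dots+q^{k-1}$. Powers of $u$ are taken modulo $n$, since $u^n=1$. $H_n(\zeta,m,t)$ is the Hopf algebra generated as a $\Bbbk$-algebra by $y,x$ subject to $y^n=1$, $x^N=0$ (where $N=\operatorname{ord}(\zeta^{mt})$) and $yx=\zeta^t xy$, with $y$ grouplike and $x$ being $(y^m,1)$-skew primitive. An $H$-module algebra is an algebra $A$ that is a left $H$-module with $h\cdot(ab)=(h_{(1)}\cdot a)(h_{(2)}\cdot b)$ and $h\cdot 1_A=\epsilon(h)1_A$. The action is inner-faithful if $I\cdot A\neq 0$ for every nonzero Hopf ideal $I$ of $H$. $A(H)$ denotes an inner-faithful $H$-module algebra which, as an algebra, is $\Bbbk[u]/(u^n-1)$ (isomorphic to the group algebra of the grouplikes $\langle y\rangle$), where $u$ can be chosen with $y\cdot u=\zeta u$. Such structures exist if and only if $\gcd(t,n/m)=1$. The Drinfel'd double $D(H)$ of $H=H_n(\zeta,m,t)$ is the Hopf algebra generated by grouplike elements $y,Y$, a $(y^m,1)$-skew primitive element $x$, and a $(1,Y^t)$-skew primitive element $X$, subject to $$y^n=Y^n=1,\quad x^N=X^N=0,\quad yx=\zeta^t xy,\quad YX=\zeta^m XY,$$ $$yY=Yy,\quad xY=\zeta^m Yx,\quad yX=\zeta^{-t}Xy,\quad xX-Xx=Y^t-y^m;$$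 it contains $H$ as the Hopf subalgebra generated by $x,y$. An extension of the $H$-action is an action of $D(H)$ making $A$ a $D(H)$-module algebra and restricting to the given action of $H$. *)

(* Defs.v *)
From HB Require Import structures.
From mathcomp Require Import all_boot all_order all_algebra.

Set Implicit Arguments.
Unset Strict Implicit.
Unset Printing Implicit Defensive.

Import GRing.Theory.
Local Open Scope ring_scope.

(* A finite sequence of pairs [:: (u_1, v_1); ...; (u_r, v_r)] stands for the
   tensor u_1 (x) v_1 + ... + u_r (x) v_r of U (x) V.  By the universal property
   of U (x) V, two sequences represent the same tensor iff no bilinear map
   separates them. *)
Definition tensor_eq (k : fieldType) (U V : lmodType k) (s1 s2 : seq (U * V)) :
    Prop :=
  forall (W : lmodType k) (b : {bilinear U -> V -> W}),
    \sum_(p <- s1) b p.1 p.2 = \sum_(p <- s2) b p.1 p.2.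

Definition trilinear (k : fieldType) (U V W Z : lmodType k)
    (f : U -> V -> W -> Z) : Prop :=
  [/\ forall v w, linear (fun u => f u v w),
      forall u w, linear (fun v => f u v w)
    & forall u v, linear (fun w => f u v w)].

Definition tensor3_eq (k : fieldType) (U V W : lmodType k)
    (s1 s2 : seq (U * V * W)) : Prop :=
  forall (Z : lmodType k) (f : U -> V -> W -> Z), trilinear f ->
    \sum_(p <- s1) f p.1.1 p.1.2 p.2 = \sum_(p <- s2) f p.1.1 p.1.2 p.2.

(* coprod h is a representative of Delta(h), i.e. the list of the pairs
   (h_(1), h_(2)) of Sweedler's notation; all axioms are stated up to equality
   in H (x) H (resp. H (x) H (x) H). *)
HB.mixin Record Algebra_isHopf (k : fieldType) H of GRing.Algebra k H := {
  coprod : H -> seq (H * H);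
  counit : {lrmorphism H -> k^o};
  antipode : {linear H -> H};
  coprod_linear : forall (c : k) (a b : H),
    tensor_eq (coprod (c *: a + b))
              ([seq (c *: p.1, p.2) | p <- coprod a] ++ coprod b);
  coprod1 : tensor_eq (coprod 1) [:: (1, 1)];
  coprodM : forall a b : H,
    tensor_eq (coprod (a * b))
              [seq (p.1 * q.1, p.2 * q.2) | p <- coprod a, q <- coprod b];
  coprodA : forall h : H,
    tensor3_eq [seq (q.1, q.2, p.2) | p <- coprod h, q <- coprod p.1]
               [seq (p.1, q.1, q.2) | p <- coprod h, q <- coprod p.2];
  counitl : forall h : H, \sum_(p <- coprod h) (counit p.1 : k) *: p.2 = h;
  counitr : forall h : H, \sum_(p <- coprod h) (counit p.2 : k) *: p.1 = h;
  antipodel : forall h : H,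
    \sum_(p <- coprod h) antipode p.1 * p.2 = (counit h : k)%:A;
  antipoder : forall h : H,
    \sum_(p <- coprod h) p.1 * antipode p.2 = (counit h : k)%:A
}.

#[short(type="hopfAlgType")]
HB.structure Definition HopfAlgebra (k : fieldType) :=
  {H of Algebra_isHopf k H & GRing.Algebra k H}.

Section HopfAlgebras.
Variables (k : fieldType) (H : hopfAlgType k).

Definition grouplike (g : H) : Prop :=
  g != 0 /\ tensor_eq (coprod g) [:: (g, g)].

Definition skew_primitive (g h c : H) : Prop :=
  tensor_eq (coprod c) [:: (g, c); (c, h)].

Record hopf_ideal (I : H -> Prop) : Prop := {
  hideal0 : I 0;
  hideal_linear : forall (c : k) a b, I a -> I b -> I (c *: a + b);
  hideal_mull : forall h a, I a -> I (h * a);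
  hideal_mulr : forall h a, I a -> I (a * h);
  (* Delta(I) is contained in I (x) H + H (x) I *)
  hideal_coprod : forall a, I a ->
    exists2 s : seq (H * H), tensor_eq (coprod a) s
      & forall p, p \in s -> I p.1 \/ I p.2;
  hideal_counit : forall a, I a -> counit a = 0;
  hideal_antipode : forall a, I a -> I (antipode a)
}.

Variable A : algType k.

Record module_algebra (act : {bilinear H -> A -> A}) : Prop := {
  mact1 : forall a, act 1 a = a;
  mactM : forall g h a, act (g * h) a = act g (act h a);
  mact_mul : forall h a b,
    act h (a * b) = \sum_(p <- coprod h) act p.1 a * act p.2 b;
  mact_unit : forall h, act h 1 = (counit h : k)%:A
}.

Definition inner_faithful (act : {bilinear H -> A -> A}) : Prop :=
  forall I : H -> Prop, hopf_ideal I -> (exists2 h, I h & h != 0) ->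
    exists h a, I h /\ act h a != 0.

End HopfAlgebras.

Definition extends_action (k : fieldType) (H D : hopfAlgType k) (A : algType k)
    (iota : H -> D) (act : {bilinear H -> A -> A})
    (actD : {bilinear D -> A -> A}) : Prop :=
  module_algebra actD /\ forall h a, actD (iota h) a = act h a.

Definition generates_algebra (k : fieldType) (B : algType k) (gs : seq B) :
    Prop :=
  forall P : B -> Prop,
    (forall c : k, P c%:A) ->
    (forall a b, P a -> P b -> P (a + b)) ->
    (forall a b, P a -> P b -> P (a * b)) ->
    (forall g, g \in gs -> P g) ->
    forall b, P b.

(* B is the k-algebra with generators gs and defining relations rel, where
   rel C cs says that the list cs of elements of C satisfies the relations. *)
Record presented_by (k : fieldType) (B : algType k) (gs : seq B)
    (rel : forall C : algType k, seq C -> Prop) : Prop := {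
  presented_gen : generates_algebra gs;
  presented_rel : rel B gs;
  presented_univ : forall (C : algType k) (cs : seq C), rel C cs ->
    exists f : {lrmorphism B -> C}, map f gs = cs
}.

Section Presentations.
Variables (k : fieldType) (zeta : k) (n m t : nat).
(* N is to be the multiplicative order of zeta ^+ (m * t). *)
Variable N : nat.

Definition H_relations (C : algType k) (s : seq C) : Prop :=
  if s is [:: y; x] then
    [/\ y ^+ n = 1, x ^+ N = 0 & y * x = zeta ^+ t *: (x * y)]
  else False.

(* H = H_n(zeta, m, t) with its generators. *)
Record is_gen_taft (H : hopfAlgType k) (y x : H) : Prop := {
  H_presented : presented_by [:: y; x] H_relations;
  H_grouplike_y : grouplike y;
  H_skew_x : skew_primitive (y ^+ m) 1 x
}.

Definition D_relations (C : algType k) (s : seq C) : Prop :=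
  if s is [:: y; Y; x; X] then
    [/\ [/\ y ^+ n = 1, Y ^+ n = 1, x ^+ N = 0 & X ^+ N = 0],
        y * x = zeta ^+ t *: (x * y) /\ Y * X = zeta ^+ m *: (X * Y),
        [/\ y * Y = Y * y, x * Y = zeta ^+ m *: (Y * x)
          & y * X = zeta ^- t *: (X * y)]
      & x * X - X * x = Y ^+ t - y ^+ m]
  else False.

(* D = D(H_n(zeta, m, t)) with its generators. *)
Record is_double (D : hopfAlgType k) (y Y x X : D) : Prop := {
  D_presented : presented_by [:: y; Y; x; X] D_relations;
  D_grouplike_y : grouplike y;
  D_grouplike_Y : grouplike Y;
  D_skew_x : skew_primitive (y ^+ m) 1 x;
  D_skew_X : skew_primitive 1 (Y ^+ t) X
}.

End Presentations.

Notation cyclic_alg k n := {poly %/ ('X^n - 1 : {poly k})}.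
Notation cyclic_gen k n := (@qpolyX k ('X^n - 1)).

Definition qnat (k : fieldType) (q : k) (j : nat) : k := \sum_(i < j) q ^+ i.

(* As u ^+ n = 1, the power u^(1-t) is written u ^+ (n + 1 - t); below t is a
   divisor of n, so that this subtraction is not truncated. *)
Definition action_formulas (k : fieldType) (zeta : k) (n t d : nat)
    (gamma delta : k) (D : hopfAlgType k) (y Y x X : D)
    (act : {bilinear D -> cyclic_alg k n -> cyclic_alg k n}) : Prop :=
  let u := cyclic_gen k n in
  [/\ act y u = zeta *: u,
      act Y u = zeta ^+ d *: u,
      act x u = gamma *: u ^+ (1 + t)
    & act X u = delta *: u ^+ (n + 1 - t)].

(* Main.v *)
(** Since [yx = zeta^t xy], [x u] is an eigenvector of [y], so
    [x u = gamma u^(1+t)]; [gamma <> 0] because otherwise the Hopf ideal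
    generated by [x] would act by zero.  In the same way the relations of the
    double give [Y u = zeta^d u] and [X u = delta u^(1-t)], and
    [xY = zeta^m Yx] forces [zeta^(dt) zeta^m = 1].  With [q = zeta^m] and
    [p = zeta^(dt) = q^-1], induction on [j] gives
    [x u^j = gamma (j)_q u^(j+t)] and [X u^j = delta (j)_p u^(j-t)].  Hence
    [xX - Xx] acts on [u^j] by [gamma delta (p^j - q^j) (n-t)_q / (p - 1)], and
    [Y^t - y^m] by [p^j - q^j].  These agree for all [j] iff they agree for
    [j = 1], that is, iff [q = p] (which means [m = n/2]) or
    [gamma delta (n-t)_q = p - 1].

    Conversely the formulas define operators on [A] satisfying the relations of
    the double.  Only [X^N = 0] is not immediate: applying [x^N = 0] to [u^j]
    shows that [j + i t] is a multiple of [ord q] for some [i < N], and by the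
    symmetry [j -> -j] this makes [X^N] vanish as well. *)

From HB Require Import structures.
Require Import Defs.
From mathcomp Require Import all_boot all_order all_algebra.
From mathcomp Require Import ring.

Set Implicit Arguments.
Unset Strict Implicit.
Unset Printing Implicit Defensive.

Import GRing.Theory.
Local Open Scope ring_scope.

(** * Hopf algebras and module algebras *)

(** Makes [tensor_eq] usable on bare functions: the two linearity hypotheses supply the bilinear
    structure over which it quantifies. *)
Lemma tensor_eq_sum (k : fieldType) (U V W : lmodType k) (b : U -> V -> W)
    (s1 s2 : seq (U * V)) :
  (forall v, linear (b^~ v)) -> (forall u, linear (b u)) ->
  tensor_eq s1 s2 -> \sum_(p <- s1) b p.1 p.2 = \sum_(p <- s2) b p.1 p.2.
Proof.
move=> bl br eq12.
pose B : {bilinear U -> V -> W} :=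
  HB.pack b (bilinear_isBilinear.Build k U V W _ _ b (bl, br)).
exact: (eq12 W B).
Qed.

Lemma sum_linear (k : fieldType) (U W : lmodType k) (I : Type) (r : seq I)
    (f : I -> U -> W) :
  (forall i, linear (f i)) -> linear (fun u => \sum_(i <- r) f i u).
Proof.
move=> f_lin c u v; rewrite scaler_sumr -big_split /=.
by apply: eq_bigr => i _; exact: f_lin.
Qed.

(** * Sweedler sums, the antipode, grouplikes and skew primitives *)

Section HopfSums.
Variables (k : fieldType) (H : hopfAlgType k).
Implicit Types (a b g h c : H).

(** [coprod h] is only a representative list, but a sum of bilinear terms depends just on the tensor
    it represents. *)
Lemma coprod_sum_linear (W : lmodType k) (b : H -> H -> W) :
  (forall v, linear (b^~ v)) -> (forall u, linear (b u)) ->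
  linear (fun h => \sum_(p <- coprod h) b p.1 p.2).
Proof.
move=> bl br c h h' /=.
rewrite (tensor_eq_sum bl br (coprod_linear c h h')) big_cat big_map /=.
congr (_ + _); rewrite scaler_sumr; apply: eq_bigr => p _.
exact: (scalable_linear (bl p.2)).
Qed.

Lemma coprodM_sum (W : lmodType k) (b : H -> H -> W) g h :
  (forall v, linear (b^~ v)) -> (forall u, linear (b u)) ->
  \sum_(p <- coprod (g * h)) b p.1 p.2 =
  \sum_(p <- coprod g) \sum_(q <- coprod h) b (p.1 * q.1) (p.2 * q.2).
Proof.
by move=> bl br; rewrite (tensor_eq_sum bl br (coprodM g h)) big_allpairs_dep.
Qed.

Lemma coprodA_sum (W : lmodType k) (f : H -> H -> H -> W) h : trilinear f ->
  \sum_(p <- coprod h) \sum_(q <- coprod p.1) f q.1 q.2 p.2 =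
  \sum_(p <- coprod h) \sum_(q <- coprod p.2) f p.1 q.1 q.2.
Proof. by move=> /(coprodA h); rewrite !big_allpairs_dep. Qed.

Lemma mulr_linearl (f : H -> H) c : linear f -> linear (fun u => f u * c).
Proof. by move=> f_lin s u v; rewrite f_lin mulrDl scalerAl. Qed.

Lemma mulr_linearr (f : H -> H) c : linear f -> linear (fun u => c * f u).
Proof. by move=> f_lin s u v; rewrite f_lin mulrDr scalerAr. Qed.

Lemma linear_comp (f : {linear H -> H}) (g : H -> H) :
  linear g -> linear (fun u => f (g u)).
Proof. by move=> g_lin s u v; rewrite g_lin linearP. Qed.

(* Both sides are convolution inverses of the multiplication H (x) H -> H. *)
Lemma antipodeM a b : antipode (a * b) = antipode b * antipode a.
Proof.
pose S : {linear H -> H} := antipode.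
pose F (a1 a2 a3 b1 b2 b3 : H) := S (a1 * b1) * (a2 * b2) * (S b3 * S a3).
pose T := \sum_(p <- coprod a) \sum_(q <- coprod p.1)
  \sum_(r <- coprod b) \sum_(s <- coprod r.1) F q.1 q.2 p.2 s.1 s.2 r.2.
(* [T] is the triple convolution of [S(ab)], [ab] and [S(b)S(a)]. After rebracketing by
   coassociativity in [a] and in [b], contracting the last two factors leaves [S(ab)]; contracting
   the first two leaves [S(b)S(a)]. *)
transitivity T.
  have -> : T = \sum_(p <- coprod a) \sum_(q <- coprod p.2)
      \sum_(r <- coprod b) \sum_(s <- coprod r.2) F p.1 q.1 q.2 r.1 s.1 s.2.
    rewrite /T (@coprodA_sum _ (fun a1 a2 a3 =>
      \sum_(r <- coprod b) \sum_(s <- coprod r.1) F a1 a2 a3 s.1 s.2 r.2)).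
      apply: eq_bigr => p _; apply: eq_bigr => q _.
      apply: (@coprodA_sum _ (F p.1 q.1 q.2)).
      split=> u v; rewrite /F.
      - by apply/mulr_linearl/mulr_linearl/linear_comp/mulr_linearr.
      - by apply/mulr_linearl/mulr_linearr/mulr_linearr.
      - by apply/mulr_linearr/mulr_linearl/linear_comp.
    split=> u v; apply: sum_linear => r; apply: sum_linear => s; rewrite /F.
    - by apply/mulr_linearl/mulr_linearl/linear_comp/mulr_linearl.
    - by apply/mulr_linearl/mulr_linearr/mulr_linearl.
    - by apply/mulr_linearr/mulr_linearr/linear_comp.
  have inner p q : \sum_(r <- coprod b) \sum_(s <- coprod r.2)
      F p q.1 q.2 r.1 s.1 s.2 = S (p * b) * (q.1 * S q.2).
    rewrite -[in RHS](counitr b) mulr_sumr raddf_sum mulr_suml /=.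
    apply: eq_bigr => r _; transitivity (S (p * r.1) *
        (q.1 * (\sum_(s <- coprod r.2) s.1 * S s.2) * S q.2)).
      rewrite !(mulr_sumr, mulr_suml); apply: eq_bigr => s _.
      by rewrite /F !mulrA.
    rewrite antipoder mulr_algr -scalerAl -scalerAr scalerAl -linearZ.
    by rewrite scalerAr.
  rewrite -{1}(counitr a) mulr_suml raddf_sum; apply: eq_bigr => p _ /=.
  under eq_bigr do rewrite inner.
  by rewrite -mulr_sumr antipoder -scalerAr mulr1 -scalerAl linearZ_LR.
have inner p r : \sum_(q <- coprod p.1) \sum_(s <- coprod r.1)
    F q.1 q.2 p.2 s.1 s.2 r.2 =
    S ((counit r.1 : k) *: r.2) * S ((counit p.1 : k) *: p.2).
  transitivity ((\sum_(q <- coprod p.1) \sum_(s <- coprod r.1)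
      S (q.1 * s.1) * (q.2 * s.2)) * (S r.2 * S p.2)).
    rewrite mulr_suml; apply: eq_bigr => q _; rewrite mulr_suml.
    by apply: eq_bigr.
  rewrite -(@coprodM_sum _ (fun g h => S g * h)); first last.
  - by move=> u; exact/mulr_linearr.
  - by move=> v; exact/mulr_linearl/linear_comp.
  rewrite antipodel rmorphM /= !linearZ_LR -!scalerAl mul1r -scalerAr scalerA.
  by rewrite [X in X *: _]mulrC.
rewrite /T; under eq_bigr => p _.
  rewrite exchange_big /=; under eq_bigr do rewrite inner.
  rewrite -mulr_suml -raddf_sum counitl; over.
by rewrite -mulr_sumr -raddf_sum counitl.
Qed.

(** The counit axiom on [g (x) g] gives [eps(g) g = g], and [g] is nonzero. *)
Lemma counit_grouplike g : grouplike g -> counit g = 1.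
Proof.
case=> g_neq0 /(@tensor_eq_sum _ _ _ _ (fun u v : H => (counit u : k) *: v)) E.
have : (counit g : k) *: g = 1 *: g.
  rewrite scale1r -[RHS](counitl g) E ?big_seq1 //= => [v|u] c a b.
    by rewrite linearP scalerDl -scalerA.
  by rewrite scalerDr !scalerA mulrC.
move/eqP; rewrite -subr_eq0 -scalerBl scaler_eq0 (negPf g_neq0) orbF.
by rewrite subr_eq0 => /eqP.
Qed.

(** The counit axiom reads [c + eps(c) h = c]; applying [eps] to [eps(c) h = 0] finishes. *)
Lemma counit_skew_primitive g h c :
  counit g = 1 -> counit h = 1 -> skew_primitive g h c -> counit c = 0.
Proof.
move=> g1 h1 /(@tensor_eq_sum _ _ _ _ (fun u v : H => (counit u : k) *: v)) E.
have : \sum_(p <- [:: (g, c); (c, h)]) (counit p.1 : k) *: p.2 = c.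
  rewrite -E ?counitl // => [v|u] s a b.
    by rewrite linearP scalerDl -scalerA.
  by rewrite scalerDr !scalerA mulrC.
rewrite big_cons big_seq1 /= g1 scale1r => /(canRL (addKr _)).
rewrite addNr => /(congr1 (@counit k H)).
rewrite linearZ /= h1 linear0 => /eqP.
by rewrite scaler_eq0 oner_eq0 orbF => /eqP.
Qed.

(** The two-sided ideal generated by [x], as the intersection of all ideals containing [x], so that
    membership is itself an induction principle. *)
Definition ideal_gen x h : Prop :=
  forall I : H -> Prop, I 0 ->
    (forall (c : k) a b, I a -> I b -> I (c *: a + b)) ->
    (forall h a, I a -> I (h * a)) -> (forall h a, I a -> I (a * h)) ->
    I x -> I h.

Lemma tensor_eq_trans (U V : lmodType k) (s1 s2 s3 : seq (U * V)) :
  tensor_eq s1 s2 -> tensor_eq s2 s3 -> tensor_eq s1 s3.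
Proof. by move=> E12 E23 W b; rewrite E12. Qed.

Lemma coprod0 : tensor_eq (coprod (0 : H)) [::].
Proof.
move=> W b; rewrite big_nil.
have [bl br] : (forall v, linear (b^~ v)) * (forall u, linear (b u)).
  by split=> [v|u] c a a'; rewrite ?linearPl ?linearPr.
have := coprod_sum_linear bl br (-1) 0 0.
by rewrite scaler0 addr0 scaleN1r addNr.
Qed.

(** Each Hopf ideal condition is stable under the ideal operations (for the antipode by
    [antipodeM]), so it is checked on [x] only, where the antipode axiom gives [S(x) = - S(g) x]. *)
Lemma ideal_gen_skew_hopf g x :
  counit g = 1 -> skew_primitive g 1 x -> hopf_ideal (ideal_gen x).
Proof.
move=> g1 x_skew.
have x0 : counit x = 0 by apply: counit_skew_primitive x_skew; rewrite ?rmorph1.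
have I0 : ideal_gen x 0 by [].
have Ix : ideal_gen x x by [].
have IP (s : k) a b :
    ideal_gen x a -> ideal_gen x b -> ideal_gen x (s *: a + b).
  by move=> Ia Ib I z lin ml mr ix; exact: (lin _ _ _ (Ia I z lin ml mr ix)
    (Ib I z lin ml mr ix)).
have Il h a : ideal_gen x a -> ideal_gen x (h * a).
  by move=> Ia I z lin ml mr ix; exact: (ml _ _ (Ia I z lin ml mr ix)).
have Ir h a : ideal_gen x a -> ideal_gen x (a * h).
  by move=> Ia I z lin ml mr ix; exact: (mr _ _ (Ia I z lin ml mr ix)).
have IZ (s : k) a : ideal_gen x a -> ideal_gen x (s *: a).
  by move=> Ia; rewrite -[_ *: _]addr0; exact: IP.
split=> //.
- move=> a /(_ (fun a => exists2 s, tensor_eq (coprod a) s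
    & forall p, p \in s -> ideal_gen x p.1 \/ ideal_gen x p.2)); apply.
  + by exists [::] => //; exact: coprod0.
  + move=> c {}a b [s Es Is] [r Er Jr].
    exists ([seq (c *: p.1, p.2) | p <- s] ++ r).
      apply: (tensor_eq_trans (coprod_linear c a b)) => W f.
      rewrite !big_cat /= Er !big_map /=; congr (_ + _).
      under eq_bigr do rewrite linearZl_LR.
      rewrite -scaler_sumr Es scaler_sumr.
      by under [RHS]eq_bigr do rewrite linearZl_LR.
    move=> p; rewrite mem_cat.
    move=> /orP[/mapP[r' /Is[] ? ->]|/Jr//]; [left|right] => //.
    exact: IZ.
  + move=> h {}a [s Es Is].
    exists [seq (p.1 * q.1, p.2 * q.2) | p <- coprod h, q <- s].
      apply: (tensor_eq_trans (coprodM h a)) => W f.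
      rewrite !big_allpairs_dep; apply: eq_bigr => p _ /=.
      apply: (tensor_eq_sum (b := fun u v => f (p.1 * u) (p.2 * v))) Es;
        move=> v c a1 a2.
        by rewrite mulrDr -scalerAr linearPl.
      by rewrite mulrDr -scalerAr linearPr.
    by move=> _ /allpairsP[[p q] [/= _ /Is[] ? ->]]; [left|right]; exact: Il.
  + move=> h {}a [s Es Is].
    exists [seq (q.1 * p.1, q.2 * p.2) | p <- coprod h, q <- s].
      apply: (tensor_eq_trans (coprodM a h)) => W f.
      rewrite !big_allpairs_dep exchange_big /=; apply: eq_bigr => p _ /=.
      apply: (tensor_eq_sum (b := fun u v => f (u * p.1) (v * p.2))) Es;
        move=> v c a1 a2.
        by rewrite mulrDl -scalerAl linearPl.
      by rewrite mulrDl -scalerAl linearPr.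
    by move=> _ /allpairsP[[p q] [/= _ /Is[] ? ->]]; [left|right]; exact: Ir.
  + exists [:: (g, x); (x, 1)] => // p.
    by rewrite !inE => /orP[]/eqP ->; [right|left].
- move=> a /(_ (fun a => counit a = 0)); apply => //.
  + by rewrite linear0.
  + by move=> c {}a b /= a0 b0; rewrite linearP /= a0 b0 scaler0 addr0.
  + by move=> h {}a /= a0; rewrite rmorphM /= a0 mulr0.
  + by move=> h {}a /= a0; rewrite rmorphM /= a0 mul0r.
- move=> a /(_ (fun a => ideal_gen x (antipode a))); apply.
  + by rewrite linear0.
  + by move=> c {}a b Ia Ib; rewrite linearP; exact: IP.
  + by move=> h {}a Ia; rewrite antipodeM; exact: Ir.
  + by move=> h {}a Ia; rewrite antipodeM; exact: Il.
  + have := antipodel x; rewrite x0 scale0r.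
    rewrite (tensor_eq_sum (b := fun u v : H => antipode u * v) _ _ x_skew);
      first last.
    * by move=> u c a1 a2; rewrite mulrDr scalerAr.
    * by move=> v c a1 a2; rewrite linearP mulrDl scalerAl.
    rewrite big_cons big_seq1 mulr1 => /eqP; rewrite addrC addr_eq0 => /eqP ->.
    rewrite -scaleN1r; exact: (IZ _ _ (Il _ _ Ix)).
Qed.

(** * Consequences of the module algebra axioms *)

Section ModuleAlgebra.
Variables (A : algType k) (act : {bilinear H -> A -> A}).
Hypothesis act_mod : module_algebra act.

Lemma mact_bilinear (a b : A) (f := fun g h : H => act g a * act h b) :
  (forall v, linear (f^~ v)) * (forall u, linear (f u)).
Proof.
split=> [v|u] c g h; rewrite /f linearPl.
  by rewrite mulrDl scalerAl.
by rewrite mulrDr scalerAr.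
Qed.

Lemma mact_grouplike g (a b : A) :
  grouplike g -> act g (a * b) = act g a * act g b.
Proof.
case=> _ /(tensor_eq_sum (mact_bilinear a b).1 (mact_bilinear a b).2).
by rewrite (mact_mul act_mod) => ->; rewrite big_seq1.
Qed.

Lemma mact_skew g h c (a b : A) : skew_primitive g h c ->
  act c (a * b) = act g a * act c b + act c a * act h b.
Proof.
move/(tensor_eq_sum (mact_bilinear a b).1 (mact_bilinear a b).2).
by rewrite (mact_mul act_mod) => ->; rewrite big_cons big_seq1.
Qed.

Lemma mactX h r (a : A) : act (h ^+ r) a = iter r (act h) a.
Proof.
elim: r => [|r IH]; first by rewrite expr0 (mact1 act_mod).
by rewrite exprS (mactM act_mod) IH.
Qed.

(** The elements acting by zero form a two-sided ideal; if it contained [x], it would contain the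
    nonzero Hopf ideal generated by [x]. *)
Lemma inner_faithful_skew g x : inner_faithful act -> counit g = 1 ->
  skew_primitive g 1 x -> x != 0 -> ~ (forall a : A, act x a = 0).
Proof.
move=> faith g1 x_skew x_neq0 x_triv.
have [|h [a [Ih /eqP[]]]] := faith _ (ideal_gen_skew_hopf g1 x_skew).
  by exists x.
suff: forall b : A, act h b = 0 by apply.
apply: (Ih (fun h => forall b : A, act h b = 0)) => //.
- by move=> b; rewrite linear0l.
- by move=> c g' g'' h0 h'0 b; rewrite linearPl h0 h'0 scaler0 addr0.
- by move=> g' g'' h0 b; rewrite (mactM act_mod) h0 linear0r.
- by move=> g' g'' h0 b; rewrite (mactM act_mod) h0.
Qed.

End ModuleAlgebra.

(** For an action of the algebra [H], the elements compatible with the product and the unit of [A]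
    form a subalgebra. *)
Lemma module_algebra_gen (A : algType k) (act : {bilinear H -> A -> A})
    (gs : seq H) :
  generates_algebra gs ->
  (forall a : A, act 1 a = a) ->
  (forall g h (a : A), act (g * h) a = act g (act h a)) ->
  (forall g, g \in gs -> forall a b : A,
    act g (a * b) = \sum_(p <- coprod g) act p.1 a * act p.2 b) ->
  (forall g, g \in gs -> act g 1 = (counit g : k)%:A) ->
  module_algebra act.
Proof.
move=> gen a1 aM gs_mul gs_unit; split=> // h; last first.
  elim/gen: h => // [c|g h g1 h1|g h g1 h1].
  - by rewrite linearZl_LR a1 linearZ /= rmorph1 [c *: _]mulr1.
  - by rewrite linearDl g1 h1 linearD scalerDl.
  - by rewrite aM h1 linearZr_LR g1 rmorphM /= scalerA mulrC.
elim/gen: h => [c|g h gM hM|g h gM hM|//] a b.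
- have [bl br] := mact_bilinear act a b.
  have lin := coprod_sum_linear bl br.
  rewrite (scalable_linear lin) /= (tensor_eq_sum bl br coprod1) big_seq1.
  by rewrite linearZl_LR !a1.
- have [bl br] := mact_bilinear act a b.
  have := coprod_sum_linear bl br 1 g h; rewrite !scale1r => ->.
  by rewrite linearDl gM hM.
- have [bl br] := mact_bilinear act a b.
  rewrite aM hM linear_sumr (coprodM_sum _ _ bl br) exchange_big /=.
  apply: eq_bigr => p _; rewrite gM; apply: eq_bigr => q _.
  by rewrite !aM.
Qed.

End HopfSums.

(** Serves for restriction along [iota] and, with [f] the identity, for uniqueness of an action. *)
Lemma module_algebra_ext (k : fieldType) (H D : hopfAlgType k) (A : algType k)
    (f : {lrmorphism H -> D}) (act : {bilinear H -> A -> A})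
    (actD : {bilinear D -> A -> A}) (gs : seq H) :
  generates_algebra gs -> module_algebra act -> module_algebra actD ->
  (forall g, g \in gs -> forall a, actD (f g) a = act g a) ->
  forall h a, actD (f h) a = act h a.
Proof.
move=> gen actM actDM act_gs; apply: gen => // [c|g h gE hE|g h gE hE] a.
- by rewrite linearZ /= rmorph1 !linearZl_LR (mact1 actM) (mact1 actDM).
- by rewrite rmorphD !linearDl gE hE.
- by rewrite rmorphM (mactM actM) (mactM actDM) gE hE.
Qed.

(** * The cyclic algebra *)

Section QNumbers.
Variables (k : fieldType).
Implicit Types q p : k.

Lemma qnat0 q : qnat q 0 = 0. Proof. by rewrite /qnat big_ord0. Qed.

Lemma qnatSr q j : qnat q j.+1 = qnat q j + q ^+ j.
Proof. by rewrite /qnat big_ord_recr. Qed.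

Lemma qnatS q j : qnat q j.+1 = q * qnat q j + 1.
Proof.
rewrite /qnat big_ord_recl expr0 addrC mulr_sumr; congr (_ + _).
by apply: eq_bigr => i _; rewrite exprS.
Qed.

Lemma qnatD q i j : qnat q (i + j) = qnat q i + q ^+ i * qnat q j.
Proof.
rewrite /qnat big_split_ord mulr_sumr /=; congr (_ + _).
by apply: eq_bigr => l _; rewrite exprD.
Qed.

Lemma subr1_qnat q j : (q - 1) * qnat q j = q ^+ j - 1.
Proof. by rewrite /qnat -subrX1. Qed.

Lemma qnat_eq0 q j : q != 1 -> (qnat q j == 0) = (q ^+ j == 1).
Proof.
move=> q1; rewrite -[RHS]subr_eq0 -subr1_qnat mulf_eq0 subr_eq0.
by rewrite (negPf q1).
Qed.

Lemma qnat_modn q n j : q != 1 -> q ^+ n = 1 -> qnat q (j %% n) = qnat q j.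
Proof.
move=> q1 qn; apply: (@mulfI _ (q - 1)); rewrite ?subr_eq0 // !subr1_qnat.
by rewrite expr_mod.
Qed.

(* The second factor on the left is the scalar by which [xX - Xx] acts on
   [u ^+ j] when [x u = u ^+ (1 + t)] and [X u = u ^+ (1 - t)]. *)
Lemma qnat_commutator p q n t j : p * q = 1 -> q != 1 -> q ^+ n = 1 ->
    (t <= n)%N ->
  (p - 1) * (qnat p j * qnat q (j + (n - t)) - qnat q j * qnat p (j + t)) =
  (p ^+ j - q ^+ j) * qnat q (n - t).
Proof.
(* With the factors [q - 1] and [p - 1] every q-integer becomes a difference [c ^+ j - 1]; then
   [p ^+ t = q ^+ (n - t)] and [p ^+ j * q ^+ j = 1] leave a polynomial identity. *)
move=> pq q1 qn t_le_n; apply: (@mulfI _ (q - 1)); first by rewrite subr_eq0.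
have pt : p ^+ t = q ^+ (n - t).
  apply: (@mulIf _ (q ^+ t)); last by rewrite -exprMn pq expr1n -exprD subnK.
  apply: contraTneq (oner_neq0 k) => qt0.
  by rewrite -qn -(subnK t_le_n) exprD qt0 mulr0 eqxx.
have pqj : p ^+ j * q ^+ j = 1 by rewrite -exprMn pq expr1n.
have -> : (q - 1) * ((p - 1) * (qnat p j * qnat q (j + (n - t)) -
    qnat q j * qnat p (j + t))) =
    ((p - 1) * qnat p j) * ((q - 1) * qnat q (j + (n - t))) -
    ((q - 1) * qnat q j) * ((p - 1) * qnat p (j + t)) by ring.
have -> : (q - 1) * ((p ^+ j - q ^+ j) * qnat q (n - t)) =
  (p ^+ j - q ^+ j) * ((q - 1) * qnat q (n - t)) by ring.
rewrite !subr1_qnat !exprD pt; ring: pqj.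
Qed.
End QNumbers.

(** * The monomial basis of the cyclic algebra and linear maps defined on it *)

Section CyclicAlgebra.
Variables (k : fieldType) (n : nat).
Hypothesis n_gt0 : (0 < n)%N.
Local Notation A := (cyclic_alg k n).
Local Notation u := (cyclic_gen k n).

Lemma size_mk_monic_cyclic : size (mk_monic ('X^n - 1 : {poly k})) = n.+1.
Proof.
by rewrite /mk_monic size_XnsubC // ltnS n_gt0 monicXnsubC //= size_XnsubC.
Qed.

Lemma cyclic_genX i : (i < n)%N -> u ^+ i = 'X^i :> {poly k}.
Proof.
move=> i_lt_n; rewrite /qpolyX -rmorphXn /=.
by apply: in_qpoly_small; rewrite size_polyXn size_mk_monic_cyclic.
Qed.

Lemma cyclic_gen_expn : u ^+ n = 1.
Proof.
apply/eqP; rewrite -subr_eq0; apply/eqP.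
rewrite /qpolyX -rmorphXn -(rmorph1 (in_qpoly ('X^n - 1))) -rmorphB /=.
apply/val_inj => /=.
rewrite /mk_monic size_XnsubC // ltnS n_gt0 monicXnsubC //=.
by rewrite Pdiv.RingMonic.rmodpp // monicXnsubC.
Qed.

Lemma cyclic_gen_mod j : u ^+ (j %% n) = u ^+ j.
Proof. exact: expr_mod cyclic_gen_expn. Qed.

Lemma coef_cyclic_gen i j : (i < n)%N -> (u ^+ i : A)`_j = (j == i)%:R.
Proof. by move=> i_lt; rewrite cyclic_genX // coefXn. Qed.

Lemma cyclic_gen_exp_neq0 j : u ^+ j != 0.
Proof.
rewrite -cyclic_gen_mod; apply: contraTneq (oner_neq0 k) => u0.
have := coef_cyclic_gen (j %% n) (ltn_pmod j n_gt0).
by rewrite u0 eqxx coef0 => /esym/eqP; rewrite negbK.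
Qed.

Lemma cyclic_decomp (a : A) : a = \sum_(i < n) a`_i *: u ^+ i.
Proof.
apply/val_inj; rewrite /= raddf_sum /=; apply/polyP => j; rewrite coef_sum.
have [j_lt|j_ge] := ltnP j n.
  rewrite (bigD1 (Ordinal j_lt)) //= coefZ coef_cyclic_gen // eqxx mulr1.
  rewrite big1 ?addr0 // => i; rewrite -val_eqE /= eq_sym => /negPf ij.
  by rewrite coefZ coef_cyclic_gen // ij mulr0.
rewrite big1 => [|i _].
  by apply: big_coef_npoly; rewrite size_mk_monic_cyclic.
rewrite coefZ coef_cyclic_gen //.
by rewrite (gtn_eqF (leq_trans (ltn_ord i) j_ge)) mulr0.
Qed.

Lemma cyclic_linear_ext (V : lmodType k) (f g : {linear A -> V}) :
  (forall j, f (u ^+ j) = g (u ^+ j)) -> f =1 g.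
Proof.
move=> fg a; rewrite (cyclic_decomp a) !linear_sum; apply: eq_bigr => i _.
by rewrite !linearZ /= fg.
Qed.

(** The eigenvalues [zeta ^+ i] for [i < n] are distinct, so every eigenspace of [f] is spanned by
    one monomial. *)
Lemma cyclic_eigenvector (zeta : k) (f : {linear A -> A}) (a : A) j :
  n.-primitive_root zeta -> (forall i, f (u ^+ i) = zeta ^+ i *: u ^+ i) ->
  f a = zeta ^+ j *: a -> exists c, a = c *: u ^+ j.
Proof.
move=> zeta_prim fu fa; exists (a`_(j %% n)).
have coef_eq0 (i : 'I_n) : (i : nat) != (j %% n)%N -> a`_i = 0.
  move=> ij; have : (f a)`_i = zeta ^+ i * a`_i.
    rewrite {1}(cyclic_decomp a) linear_sum /= raddf_sum coef_sum (bigD1 i) //=.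
    rewrite linearZ /= fu scalerA coefZ coef_cyclic_gen // eqxx mulr1 mulrC.
    rewrite big1 ?addr0 // => l; rewrite -val_eqE /= eq_sym => /negPf il.
    by rewrite linearZ /= fu scalerA coefZ coef_cyclic_gen // il mulr0.
  rewrite fa coefZ => /eqP; rewrite -subr_eq0 -mulrBl mulf_eq0 subr_eq0.
  rewrite (eq_prim_root_expr zeta_prim) [(i %% n)%N]modn_small //.
  by rewrite eq_sym (negPf ij) => /eqP.
rewrite [LHS]cyclic_decomp (bigD1 (Ordinal (ltn_pmod j n_gt0))) //=.
rewrite cyclic_gen_mod big1 ?addr0 // => i; rewrite -val_eqE /= => ij.
by rewrite coef_eq0 // scale0r.
Qed.

(** Linear extension of [u ^+ i |-> F i] from [i < n]; for it to hold at all exponents [F] has to be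
    [n]-periodic. *)
Definition cyclic_lin (F : nat -> A) (a : A) : A := \sum_(i < n) a`_i *: F i.

Fact cyclic_lin_is_linear F : linear (cyclic_lin F).
Proof.
move=> c a b; rewrite /cyclic_lin scaler_sumr -big_split /=.
by apply: eq_bigr => i _; rewrite coefD coefZ scalerDl scalerA.
Qed.

HB.instance Definition _ F := GRing.isLinear.Build k A A _ (cyclic_lin F)
  (cyclic_lin_is_linear F).

Lemma cyclic_linE F j : (forall i, F (i %% n)%N = F i) ->
  cyclic_lin F (u ^+ j) = F j.
Proof.
move=> Fmod; rewrite -cyclic_gen_mod -[RHS]Fmod /cyclic_lin.
rewrite (bigD1 (Ordinal (ltn_pmod j n_gt0))) //= coef_cyclic_gen ?ltn_pmod //.
rewrite eqxx scale1r big1 ?addr0 // => i; rewrite -val_eqE /= => /negPf ij.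
by rewrite coef_cyclic_gen ?ltn_pmod // ij scale0r.
Qed.

(** Ensures that the endomorphism ring of [A] is a nonzero ring, hence an algebra to which a
    presentation can be mapped. *)
Lemma dim_cyclic : (0 < dim A)%N.
Proof. by rewrite -dimvf dim_polyn size_mk_monic_cyclic. Qed.
End CyclicAlgebra.

(* The product of the library's [lfun_algType] is composition in the opposite
   order. *)
Section EndAlgebra.
Variables (R : comNzRingType) (V : vectType R).
Hypothesis V_proper : (0 < dim V)%N.

Let endo_nzRing : nzRingType := lfun_comp_nzRingType V_proper.
Let endo_lalg : lalgType R :=
  HB.pack 'End(V) endo_nzRing
    (GRing.Lmodule_isLalgebra.Build R endo_nzRing
       (fun a f g => comp_lfunZl a f g)).
Definition endo_alg : algType R :=
  HB.pack 'End(V) endo_lalg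
    (GRing.Lalgebra_isAlgebra.Build R endo_lalg
       (fun a f g => comp_lfunZr a f g)).

Lemma endo1E (v : V) : (1 : endo_alg) v = v.
Proof. exact: id_lfunE. Qed.
Lemma endoME (f g : endo_alg) v : (f * g) v = f (g v).
Proof. exact: comp_lfunE. Qed.
Lemma endoXE (f : endo_alg) r v : (f ^+ r) v = iter r f v.
Proof. by elim: r => [|r IH]; rewrite ?expr0 ?endo1E // exprS endoME IH. Qed.
End EndAlgebra.

(** * Module algebra structures on the cyclic algebra *)

Section CyclicModuleAlgebra.
Variables (k : fieldType) (n : nat) (n_gt0 : (0 < n)%N) (H : hopfAlgType k).
Local Notation A := (cyclic_alg k n).
Local Notation u := (cyclic_gen k n).
Variable act : {bilinear H -> A -> A}.
Hypothesis act_mod : module_algebra act.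

Lemma iter_weighted_shift (f : {linear A -> A}) (w : nat -> k) s :
  (forall j, f (u ^+ j) = w j *: u ^+ (j + s)) -> forall r j,
  iter r f (u ^+ j) = (\prod_(i < r) w (j + i * s)%N) *: u ^+ (j + r * s).
Proof.
move=> fu; elim=> [|r IH] j; first by rewrite big_ord0 scale1r mul0n addn0.
rewrite iterS IH linearZ /= fu scalerA big_ord_recr /=; congr (_ *: u ^+ _).
by rewrite mulSn addnA addnAC.
Qed.

Lemma mact_eigen g c j : grouplike g -> act g u = c *: u ->
  act g (u ^+ j) = c ^+ j *: u ^+ j.
Proof.
move=> g_gl gu; elim: j => [|j IH].
  by rewrite !expr0 (mact_unit act_mod) counit_grouplike.
rewrite !exprS (mact_grouplike act_mod) // gu IH -scalerAl -scalerAr.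
by rewrite scalerA.
Qed.

(** The skew Leibniz rule on [u * u ^+ j] is the recursion [(j+1)_q = q (j)_q + 1]. *)
Lemma mact_skew_left g c q gamma s j : grouplike g -> skew_primitive g 1 c ->
  act g u = q *: u -> act c u = gamma *: u ^+ (1 + s) ->
  act c (u ^+ j) = (gamma * qnat q j) *: u ^+ (j + s).
Proof.
move=> /counit_grouplike g1 c_skew gu cu; elim: j => [|j IH].
  rewrite qnat0 mulr0 scale0r expr0 (mact_unit act_mod).
  by rewrite (counit_skew_primitive g1 _ c_skew) ?rmorph1 // scale0r.
rewrite exprS (mact_skew act_mod _ _ c_skew) gu IH cu (mact1 act_mod) qnatS.
rewrite -!scalerAl -scalerAr -exprS -addSn scalerA -exprD addnAC.
by rewrite -scalerDl; congr (_ *: _); ring.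
Qed.

(** Here the grouplike acts on the factor [u ^+ j], so the recursion is [(j+1)_p = (j)_p + p^j]. *)
Lemma mact_skew_right h c p gamma s j : grouplike h -> skew_primitive 1 h c ->
  act h u = p *: u -> act c u = gamma *: u ^+ (1 + s) ->
  act c (u ^+ j) = (gamma * qnat p j) *: u ^+ (j + s).
Proof.
move=> h_gl c_skew hu cu; elim: j => [|j IH].
  rewrite qnat0 mulr0 scale0r expr0 (mact_unit act_mod).
  by rewrite (counit_skew_primitive _ _ c_skew) ?rmorph1 ?counit_grouplike
    ?scale0r.
rewrite exprS (mact_skew act_mod _ _ c_skew) IH cu (mact1 act_mod) qnatSr.
rewrite (mact_eigen _ h_gl hu) -!scalerAl -!scalerAr -exprS -addSn scalerA.
rewrite -exprD addnAC.
by rewrite -scalerDl; congr (_ *: _); rewrite mulrDr.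
Qed.

(** Both sides are bilinear in [a] and [b], so monomials suffice, and any representative [s] of the
    coproduct will do. *)
Lemma mact_mul_cyclic c (s : seq (H * H)) : tensor_eq (coprod c) s ->
  (forall i j, act c (u ^+ i * u ^+ j) =
     \sum_(p <- s) act p.1 (u ^+ i) * act p.2 (u ^+ j)) ->
  forall a b : A, act c (a * b) = \sum_(p <- coprod c) act p.1 a * act p.2 b.
Proof.
move=> c_s cu a b; have [bl br] := mact_bilinear act a b.
rewrite (tensor_eq_sum bl br c_s).
pose B (a b : A) := \sum_(p <- s) act p.1 a * act p.2 b.
have Bl b' : linear (B^~ b').
  apply: sum_linear => p r a1 a2.
  by rewrite linearPr mulrDl scalerAl.
have Br a' : linear (B a').
  apply: sum_linear => p r b1 b2.
  by rewrite linearPr mulrDr scalerAr.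
have Cl b' : linear (fun a => act c (a * b')).
  by move=> r a1 a2; rewrite mulrDl -scalerAl linearPr.
have Cr a' : linear (fun b => act c (a' * b)).
  by move=> r b1 b2; rewrite mulrDr -scalerAr linearPr.
pose lin f (fP : linear f) : {linear A -> A} :=
  HB.pack f (GRing.isLinear.Build k A A _ f fP).
apply: (cyclic_linear_ext n_gt0 (f := lin _ (Cl b)) (g := lin _ (Bl b))) => i.
apply: (cyclic_linear_ext n_gt0 (f := lin _ (Cr _)) (g := lin _ (Br _))) => j.
exact: cu.
Qed.

Lemma mact_expr_eigen g c r (a : A) :
  act g a = c *: a -> act (g ^+ r) a = c ^+ r *: a.
Proof.
move=> ga; elim: r => [|r IH]; first by rewrite !expr0 (mact1 act_mod) scale1r.
by rewrite !exprSr (mactM act_mod) ga linearZr_LR IH scalerA mulrC.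
Qed.

End CyclicModuleAlgebra.

Lemma grouplikeX (k : fieldType) (H : hopfAlgType k) (g : H) r :
  grouplike g -> grouplike (g ^+ r).
Proof.
move=> g_gl; have g1 := counit_grouplike g_gl; case: g_gl => _ g_gl; split.
  apply/eqP => gr0; have /eqP : counit (g ^+ r) = 1.
    by rewrite rmorphXn /= g1 expr1n.
  by rewrite gr0 linear0 eq_sym oner_eq0.
elim: r => [|r IH]; first by rewrite !expr0; exact: coprod1.
rewrite exprS; apply: tensor_eq_trans (coprodM _ _) _ => W b.
rewrite big_allpairs_dep.
have [bl br] : (forall v, linear (b^~ v)) * (forall u, linear (b u)).
  by split=> [v|u] c a a'; rewrite ?linearPl ?linearPr.
have lin (p : H * H) : (forall v, linear (fun u => b (p.1 * u) (p.2 * v))) *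
    (forall u, linear (fun v => b (p.1 * u) (p.2 * v))).
  by split=> [v|u] c a a'; rewrite mulrDr -scalerAr ?linearPl ?linearPr.
have lin' (v : H * H) : (forall p, linear (fun q => b (q * v.1) (p * v.2))) *
    (forall q, linear (fun p => b (q * v.1) (p * v.2))).
  by split=> [w|w] c a a'; rewrite mulrDl -scalerAl ?linearPl ?linearPr.
under eq_bigr do rewrite (tensor_eq_sum (lin _).1 (lin _).2 IH) big_seq1.
by rewrite (tensor_eq_sum (lin' (_, _)).1 (lin' (_, _)).2 g_gl) !big_seq1.
Qed.

(** * Arithmetic of the powers of [zeta] *)

Section RootsOfUnity.
Variables (k : fieldType) (n m t : nat) (zeta : k).
Hypothesis (n_gt0 : (0 < n)%N) (m_dvd_n : (m %| n)%N) (t_dvd_n : (t %| n)%N).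
Hypothesis n_ndvd_mt : ~~ (n %| m * t)%N.
Hypothesis zeta_prim : n.-primitive_root zeta.

Lemma q_neq1 : zeta ^+ m != 1.
Proof.
by rewrite -(prim_order_dvd zeta_prim); apply: contra n_ndvd_mt => /dvdn_mulr->.
Qed.

Lemma q_expn : (zeta ^+ m) ^+ n = 1.
Proof. by rewrite exprAC (prim_expr_order zeta_prim) expr1n. Qed.

Lemma zeta_neq0 : zeta != 0.
Proof. 
by rewrite (prim_root_eq0 zeta_prim) -lt0n. Qed.

Lemma t_le_n : (t <= n)%N. Proof. exact: dvdn_leq. Qed.

(** Otherwise [q ^+ (n - t) = 1], hence [q ^+ t = 1] and [n] divides [m * t]. This is the
    denominator in the relation for [gamma * delta]. *)
Lemma qnat_subn_neq0 : qnat (zeta ^+ m) (n - t) != 0.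
Proof.
rewrite qnat_eq0 ?q_neq1 //; apply: contra n_ndvd_mt => /eqP E.
rewrite (prim_order_dvd zeta_prim) exprM; apply/eqP.
by rewrite -[LHS]mul1r -[X in X * _]E -exprD subnK ?t_le_n // q_expn.
Qed.

(** With [n = c m], the hypothesis gives [c | 2]; [c = 1] would make [n = m] divide [m * t]. *)
Lemma double_m_eq_n : (zeta ^+ m) ^+ 2 = 1 -> m.*2 = n.
Proof.
rewrite -exprM muln2 => /eqP; rewrite -(prim_order_dvd zeta_prim).
case/dvdnP: m_dvd_n n_ndvd_mt => c -> n_ndvd.
rewrite -mul2n dvdn_pmul2r; last first.
  by case: (m) n_ndvd => //; rewrite muln0.
case: c n_ndvd => [|[|[|c]]] //; first by rewrite mul1n dvdn_mulr.
Qed.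

(** Both sides say that [n] divides [m + d * t]. *)
Lemma congr_exp d :
  (m = - (d * t)%N%:Z %[mod n])%Z <-> zeta ^+ (d * t) * zeta ^+ m = 1.
Proof.
have -> : zeta ^+ (d * t) * zeta ^+ m = zeta ^+ (m + d * t).
  by rewrite addnC exprD.
split=> [/eqP|/eqP]; last move=> E; [|apply/eqP; move: E].
  rewrite eqz_mod_dvd opprK -PoszD dvdzE /= => E.
  by apply/eqP; rewrite -(prim_order_dvd zeta_prim).
by rewrite -(prim_order_dvd zeta_prim) eqz_mod_dvd opprK -PoszD dvdzE.
Qed.

End RootsOfUnity.

(** * Weighted cyclic shifts, the shape of all generators as operators *)

Section ShiftOperators.
Variables (k : fieldType) (n : nat) (n_gt0 : (0 < n)%N).
Local Notation A := (cyclic_alg k n).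
Local Notation u := (cyclic_gen k n).
Local Notation E := (endo_alg (dim_cyclic k n_gt0)).

Definition shift_op (w : nat -> k) (s : nat) : E :=
  linfun (cyclic_lin (fun i => w (i %% n)%N *: u ^+ (i + s))).

Lemma shift_opE w s j : (forall i, w (i %% n)%N = w i) ->
  shift_op w s (u ^+ j) = w j *: u ^+ (j + s).
Proof.
move=> w_mod; rewrite lfunE /= cyclic_linE // => [|i]; first by rewrite w_mod.
by rewrite modn_mod !exprD cyclic_gen_mod.
Qed.

Lemma endo_cyclic_ext (f g : E) :
  (forall j, f (u ^+ j) = g (u ^+ j)) -> f = g.
Proof. by move=> fg; apply/lfunP; exact: cyclic_linear_ext. Qed.

Lemma shift_opX w s r j : (forall i, w (i %% n)%N = w i) ->
  (shift_op w s ^+ r) (u ^+ j) =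
  (\prod_(i < r) w (j + i * s)%N) *: u ^+ (j + r * s).
Proof.
move=> w_mod; rewrite endoXE; apply: iter_weighted_shift => i.
exact: shift_opE.
Qed.

(** The [N]-th power scales [u ^+ j] by the product of the weights met along [j, j + s, ...]; one
    zero among them kills it. *)
Lemma shift_op_nilp w s N : (forall i, w (i %% n)%N = w i) ->
  (forall j, exists2 i, (i < N)%N & w (j + i * s)%N = 0) ->
  shift_op w s ^+ N = 0.
Proof.
move=> w_mod w0; apply: endo_cyclic_ext => j; rewrite shift_opX //.
have [i i_lt wi0] := w0 j.
by rewrite (bigD1 (Ordinal i_lt)) //= wi0 mul0r scale0r zero_lfunE.
Qed.

End ShiftOperators.

(** * What the given action of [H_n(zeta, m, t)] forces *)

Section TaftAction.
Variables (k : fieldType) (n m t : nat) (zeta : k).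
Hypothesis (n_gt0 : (0 < n)%N) (t_dvd_n : (t %| n)%N).
Hypothesis n_ndvd_mt : ~~ (n %| m * t)%N.
Hypothesis zeta_prim : n.-primitive_root zeta.
Variables (N : nat) (H : hopfAlgType k) (y x : H).
Hypothesis N_ord : N.-primitive_root (zeta ^+ (m * t)).
Hypothesis presH : is_gen_taft zeta n m t N y x.
Local Notation A := (cyclic_alg k n).
Local Notation u := (cyclic_gen k n).
Local Notation q := (zeta ^+ m).

Lemma N_gt1 : (1 < N)%N.
Proof.
have N_gt0 := prim_order_gt0 N_ord.
rewrite ltn_neqAle N_gt0 andbT; apply: contraNneq n_ndvd_mt => N1.
by rewrite (prim_order_dvd zeta_prim) -[_ ^+ _]expr1 N1 (prim_expr_order N_ord).
Qed.

Lemma t_lt_n : (t < n)%N.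
Proof.
rewrite ltn_neqAle dvdn_leq // andbT; apply: contraNneq n_ndvd_mt => ->.
exact: dvdn_mull.
Qed.

(** The universal property maps [x] to a nonzero operator. Hence the Hopf ideal generated by [x] is
    nonzero, as inner faithfulness requires. *)
Lemma taft_x_neq0 : x != 0.
Proof.
(* [x0] sends 1 to [u ^+ t] and kills the other powers of [u], so [x0^2 = 0]. *)
pose y0 := shift_op n_gt0 (fun i => zeta ^+ i) 0.
pose x0 := shift_op n_gt0 (fun i => (i %% n == 0)%N%:R : k) t.
have y0E j : y0 (u ^+ j) = zeta ^+ j *: u ^+ j.
  by rewrite shift_opE ?addn0 // => i; exact: prim_expr_mod.
have x0E j : x0 (u ^+ j) = (j %% n == 0)%N%:R *: u ^+ (j + t).
  by rewrite shift_opE // => i; rewrite modn_mod.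
have t_gt0 : (0 < t)%N by exact: dvdn_gt0 t_dvd_n.
have [|f [_ fx]] := presented_univ (H_presented presH) (cs := [:: y0; x0]).
  split.
  - apply: endo_cyclic_ext => j; rewrite shift_opX; last first.
      by move=> i; exact: prim_expr_mod.
    under eq_bigr do rewrite muln0 addn0.
    rewrite prodr_const card_ord muln0 addn0 exprAC (prim_expr_order zeta_prim).
    by rewrite expr1n scale1r endo1E.
  - apply: shift_op_nilp => [i|j]; first by rewrite modn_mod.
    (* The weight vanishes at [j] unless [n | j], and then it vanishes at [j + t], because
       [0 < t < n]. *)
    case: (eqVneq (j %% n)%N 0%N) => [j0|j_neq0]; last first.
      by exists 0%N; [exact: ltnW N_gt1 | rewrite mul0n addn0 (negPf j_neq0)].
    exists 1%N; first exact: N_gt1.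
    by rewrite mul1n -modnDml j0 add0n modn_small ?t_lt_n // (gtn_eqF t_gt0).
  - apply: endo_cyclic_ext => j; rewrite scale_lfunE !endoME y0E x0E.
    rewrite !linearZ /= y0E x0E !scalerA.
    case: eqP => _; last by rewrite !mulr0 !mul0r !scale0r.
    by rewrite mulr1 mul1r exprD mulrC.
apply: contraTneq (cyclic_gen_exp_neq0 k n_gt0 t) => x_eq0; rewrite negbK.
have := x0E 0%N; rewrite -fx x_eq0 linear0 mod0n scale1r add0n => <-.
by rewrite zero_lfunE.
Qed.

Variable act : {bilinear H -> A -> A}.
Hypothesis act_mod : module_algebra act.
Hypothesis act_faithful : inner_faithful act.
Hypothesis act_y : act y u = zeta *: u.

Lemma taft_action : exists2 gamma, gamma != 0 & act x u = gamma *: u ^+ (1 + t).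
Proof.
have y_gl := H_grouplike_y presH.
have [_ _ yx] := presented_rel (H_presented presH).
have [gamma xu] : exists gamma, act x u = gamma *: u ^+ (1 + t).
  apply: (cyclic_eigenvector n_gt0 (f := act y) zeta_prim).
    by move=> i; exact: mact_eigen.
  rewrite /= -(mactM act_mod) yx linearZl_LR (mactM act_mod) act_y linearZr_LR.
  by rewrite scalerA -exprSr add1n.
exists gamma => //; apply/eqP => gamma0.
have g1 : counit (y ^+ m) = 1 by apply/counit_grouplike/grouplikeX.
apply: (inner_faithful_skew act_mod act_faithful g1 (H_skew_x presH)).
  exact: taft_x_neq0.
move=> a; rewrite (@cyclic_linear_ext k n n_gt0 _ (act x) \0) // => j.
rewrite /= (mact_skew_left act_mod j (grouplikeX m y_gl) (H_skew_x presH)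
  (mact_expr_eigen act_mod m act_y) xu).
by rewrite gamma0 mul0r scale0r.
Qed.

(** [x ^+ N = 0] on [u ^+ j] makes some factor [gamma (j + i t)_q] vanish. This is what later gives
    nilpotency of the constructed operators. *)
Lemma taft_orbit j : exists2 i, (i < N)%N & q ^+ (j + i * t) = 1.
Proof.
have [gamma gamma_neq0 xu] := taft_action.
have y_gl := H_grouplike_y presH.
have [_ xN _] := presented_rel (H_presented presH).
have xE i := mact_skew_left act_mod i (grouplikeX m y_gl) (H_skew_x presH)
  (mact_expr_eigen act_mod m act_y) xu.
have := mactX act_mod x N (u ^+ j).
rewrite xN linear0l (iter_weighted_shift (f := act x) xE) => /esym/eqP.
rewrite scaler_eq0 (negPf (cyclic_gen_exp_neq0 k n_gt0 _)) orbF.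
rewrite prodf_seq_eq0 => /hasP[i _]; rewrite mulf_eq0 (negPf gamma_neq0) /=.
by rewrite qnat_eq0 ?(q_neq1 n_ndvd_mt zeta_prim) // => /eqP; exists i.
Qed.

End TaftAction.

(** * Actions of the Drinfel'd double *)

(** The shifts by [t] and [n - t] cancel since [u ^+ n = 1], so the commutator is diagonal. *)
Lemma shift_commutator (k : fieldType) (n t : nat) (n_gt0 : (0 < n)%N)
    (p q gamma delta : k) (f g : {linear cyclic_alg k n -> cyclic_alg k n})
    (u := cyclic_gen k n) : (t <= n)%N ->
  (forall j, f (u ^+ j) = (gamma * qnat q j) *: u ^+ (j + t)) ->
  (forall j, g (u ^+ j) = (delta * qnat p j) *: u ^+ (j + (n - t))) ->
  forall j, f (g (u ^+ j)) - g (f (u ^+ j)) =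
    (gamma * delta * (qnat p j * qnat q (j + (n - t)) -
                      qnat q j * qnat p (j + t))) *: u ^+ j.
Proof.
move=> t_le fE gE j.
rewrite fE gE [f _]linearZ [g _]linearZ /= fE gE !scalerA -!addnA subnK //.
rewrite subnKC // exprD (cyclic_gen_expn k n_gt0) mulr1 -scalerBl.
by congr (_ *: _); ring.
Qed.

(** * Necessary form of an action of the double *)

Section DoubleAction.
Variables (k : fieldType) (n m t : nat) (zeta : k).
Hypothesis (n_gt0 : (0 < n)%N) (m_dvd_n : (m %| n)%N) (t_dvd_n : (t %| n)%N).
Hypothesis n_ndvd_mt : ~~ (n %| m * t)%N.
Hypothesis zeta_prim : n.-primitive_root zeta.
Variables (N : nat) (D : hopfAlgType k) (y Y x X : D).
Hypothesis presD : is_double zeta n m t N y Y x X.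
Local Notation A := (cyclic_alg k n).
Local Notation u := (cyclic_gen k n).
Local Notation q := (zeta ^+ m).
Implicit Types (act : {bilinear D -> A -> A}) (gamma delta : k) (d : nat).

Lemma action_formulas_powers act gamma delta d : module_algebra act ->
  action_formulas zeta t d gamma delta y Y x X act -> forall j,
  [/\ act y (u ^+ j) = zeta ^+ j *: u ^+ j,
      act Y (u ^+ j) = (zeta ^+ d) ^+ j *: u ^+ j,
      act x (u ^+ j) = (gamma * qnat q j) *: u ^+ (j + t)
    & act X (u ^+ j) =
        (delta * qnat (zeta ^+ (d * t)) j) *: u ^+ (j + (n - t))].
Proof.
move=> act_mod [yu Yu xu Xu] j.
have t_le := t_le_n n_gt0 t_dvd_n.
have y_gl := D_grouplike_y presD; have Y_gl := D_grouplike_Y presD.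
split; [exact: mact_eigen | exact: mact_eigen | |].
  apply: (mact_skew_left act_mod j (grouplikeX m y_gl) (D_skew_x presD)) xu.
  exact: mact_expr_eigen.
apply: (mact_skew_right act_mod j (grouplikeX t Y_gl) (D_skew_X presD) _ _).
  (* The base of the q-integers for [X] is the eigenvalue [zeta ^+ (d * t)] of [Y ^+ t] on [u]. *)
  by rewrite exprM; exact: mact_expr_eigen.
by rewrite Xu addnBA // [(1 + n)%N]addnC.
Qed.

(** The relation for [xX - Xx] is evaluated at [u] alone. By [qnat_commutator] the factor [p - q]
    appears on both sides; it is nonzero because [p = q] would give [q ^+ 2 = 1], hence
    [m = n/2]. *)
Lemma action_formulas_relation act gamma delta d : module_algebra act ->
  action_formulas zeta t d gamma delta y Y x X act ->
  zeta ^+ (d * t) * q = 1 -> m.*2 <> n ->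
  gamma * delta = (zeta ^- m - 1) / qnat q (n - t).
Proof.
move=> act_mod formulas; set p := zeta ^+ (d * t) => pq m2.
have powers := action_formulas_powers act_mod formulas.
have xE j : act x (u ^+ j) = (gamma * qnat q j) *: u ^+ (j + t).
  by case: (powers j).
have XE j : act X (u ^+ j) = (delta * qnat p j) *: u ^+ (j + (n - t)).
  by case: (powers j).
have [yu Yu _ _] := formulas.
have q1 := q_neq1 n_ndvd_mt zeta_prim.
have qn := q_expn m zeta_prim.
have t_le := t_le_n n_gt0 t_dvd_n.
have q_neq0 : q != 0 by rewrite expf_neq0 // (zeta_neq0 n_gt0 zeta_prim).
have pE : p = zeta ^- m by rewrite -[p]mulr1 -(mulfV q_neq0) mulrA pq mul1r.
have [_ _ _ xXc] := presented_rel (D_presented presD).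
have := congr1 (fun h => act h (u ^+ 1)) xXc.
rewrite /= !linearBl !(mactM act_mod) (shift_commutator n_gt0 t_le xE XE) expr1.
rewrite (mact_expr_eigen act_mod m yu) (mact_expr_eigen act_mod t Yu).
rewrite -exprM -/p.
move/eqP; rewrite -scalerBl -subr_eq0 -scalerBl scaler_eq0.
have /negPf -> : u != 0 by rewrite -[u]expr1; exact: cyclic_gen_exp_neq0.
rewrite orbF subr_eq0 => /eqP gdE.
have p_neq_q : p != q.
  apply/eqP => p_eq_q; apply: m2.
  apply: (double_m_eq_n m_dvd_n n_ndvd_mt zeta_prim).
  by rewrite expr2 -{1}p_eq_q.
have Q_neq0 := qnat_subn_neq0 n_gt0 t_dvd_n n_ndvd_mt zeta_prim.
rewrite -pE; apply: (canRL (mulfK Q_neq0)).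
apply: (@mulfI _ (p - q)); first by rewrite subr_eq0.
have := qnat_commutator 1 pq q1 qn t_le; rewrite !expr1 => C1.
by rewrite [RHS]mulrC -[in RHS]gdE [RHS]mulrCA C1; ring.
Qed.

Lemma action_formulas_ext act act' gamma delta d : module_algebra act ->
  module_algebra act' ->
  action_formulas zeta t d gamma delta y Y x X act ->
  action_formulas zeta t d gamma delta y Y x X act' ->
  forall h a, act' h a = act h a.
Proof.
move=> act_mod act'_mod /(action_formulas_powers act_mod) E.
move=> /(action_formulas_powers act'_mod) E'.
have gen := presented_gen (D_presented presD).
apply: (module_algebra_ext (f := idfun) gen) => //.
move=> g g_in a; apply: (cyclic_linear_ext n_gt0) => j.
have [[Ey EY Ex EX] [Ey' EY' Ex' EX']] := (E j, E' j).
move: g_in; rewrite !inE => /or4P[]/eqP -> /=.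
- by rewrite Ey Ey'.
- by rewrite EY EY'.
- by rewrite Ex Ex'.
- by rewrite EX EX'.
Qed.

Lemma double_action_formulas act gamma : module_algebra act ->
  act y u = zeta *: u -> gamma != 0 -> act x u = gamma *: u ^+ (1 + t) ->
  exists delta d, [/\ (0 < d < n)%N, zeta ^+ (d * t) * q = 1
    & action_formulas zeta t d gamma delta y Y x X act].
Proof.
move=> act_mod yu gamma_neq0 xu.
have [y_gl Y_gl] := (D_grouplike_y presD, D_grouplike_Y presD).
have [[_ Yn _ _] _ [yY xY yX] _] := presented_rel (D_presented presD).
have u_neq0 j : u ^+ j != 0 by exact: cyclic_gen_exp_neq0.
have t_le := t_le_n n_gt0 t_dvd_n.
have yE j : act y (u ^+ j) = zeta ^+ j *: u ^+ j by exact: mact_eigen.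
have [c Yu] : exists c, act Y u = c *: u ^+ 1.
  apply: (cyclic_eigenvector n_gt0 (f := act y) zeta_prim yE).
  by rewrite /= -(mactM act_mod) yY (mactM act_mod) yu linearZr_LR.
rewrite expr1 in Yu.
have cn : c ^+ n = 1.
  have := mact_expr_eigen act_mod n Yu; rewrite Yn (mact1 act_mod).
  rewrite -[LHS]scale1r => /eqP; rewrite -subr_eq0 -scalerBl scaler_eq0.
  by rewrite -[u]expr1 (negPf (u_neq0 _)) orbF subr_eq0 => /eqP.
(* [Y ^+ n = 1] makes [c] an [n]-th root of unity, which yields the exponent [d < n]. *)
have [[d d_lt] /= cE] := prim_rootP zeta_prim cn; rewrite {}cE in Yu cn.
have [delta Xu] : exists delta, act X u = delta *: u ^+ (n + 1 - t).
  apply: (cyclic_eigenvector n_gt0 (f := act y) zeta_prim yE).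
  rewrite /= -(mactM act_mod) yX linearZl_LR (mactM act_mod) yu linearZr_LR.
  rewrite scalerA; congr (_ *: _).
  have z_neq0 : zeta ^+ t != 0.
    by rewrite expf_neq0 // (zeta_neq0 n_gt0 zeta_prim).
  apply: (mulfI z_neq0); rewrite mulVKf // -exprD subnKC ?addn1 ?leqW //.
  by rewrite exprS (prim_expr_order zeta_prim) mulr1.
have formulas : action_formulas zeta t d gamma delta y Y x X act by [].
have [_ YE _ _] := action_formulas_powers act_mod formulas (1 + t).
(* Comparing both sides of [xY = zeta^m Yx] on [u]; [gamma != 0] permits the cancellation. *)
have pq : zeta ^+ (d * t) * q = 1.
  have := congr1 (fun h => act h u) xY; rewrite /= linearZl_LR !(mactM act_mod).
  rewrite Yu linearZr_LR xu linearZr_LR YE !scalerA => /eqP.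
  rewrite -subr_eq0 -scalerBl scaler_eq0 (negPf (u_neq0 _)) orbF.
  have -> : zeta ^+ d * gamma - q * gamma * (zeta ^+ d) ^+ (1 + t) =
      zeta ^+ d * gamma * (1 - zeta ^+ (d * t) * q).
    by rewrite exprD expr1 exprM; ring.
  rewrite !mulf_eq0 expf_eq0 (negPf (zeta_neq0 n_gt0 zeta_prim)) andbF.
  by rewrite (negPf gamma_neq0) subr_eq0 => /eqP.
exists delta, d; split=> //; rewrite d_lt andbT lt0n.
(* [d = 0] would force [q = 1]. *)
apply: contraNneq (q_neq1 n_ndvd_mt zeta_prim) => d0.
by rewrite -pq d0 mul0n expr0 mul1r.
Qed.

(** * Construction of an action of the double from the scalars *)

Section Construction.
Variables (gamma delta : k) (d : nat).
Local Notation p := (zeta ^+ (d * t)).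
Hypothesis pq : p * q = 1.
Hypothesis gamma_delta :
  m.*2 <> n -> gamma * delta = (zeta ^- m - 1) / qnat q (n - t).
Hypothesis orbit : forall j, exists2 i, (i < N)%N & q ^+ (j + i * t) = 1.

Local Notation E := (endo_alg (dim_cyclic k n_gt0)).
Let y0 : E := shift_op n_gt0 (fun j => zeta ^+ j) 0.
Let Y0 : E := shift_op n_gt0 (fun j => (zeta ^+ d) ^+ j) 0.
Let x0 : E := shift_op n_gt0 (fun j => gamma * qnat q j) t.
(** Shift lengths are natural numbers, so [-t] is represented by [n - t]. *)
Let X0 : E := shift_op n_gt0 (fun j => delta * qnat p j) (n - t).

Let q1 : q != 1 := q_neq1 n_ndvd_mt zeta_prim.
Let qn : q ^+ n = 1 := q_expn m zeta_prim.

Let p1 : p != 1.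
Proof.
by apply: contraNneq q1 => p_eq1; move: pq; rewrite p_eq1 mul1r => ->.
Qed.

Let pn : p ^+ n = 1. Proof. exact: q_expn. Qed.

Let zd_mod i : (zeta ^+ d) ^+ (i %% n) = (zeta ^+ d) ^+ i.
Proof. by apply: expr_mod; exact: q_expn. Qed.

Let y0E j : y0 (u ^+ j) = zeta ^+ j *: u ^+ j.
Proof. by rewrite shift_opE ?addn0 // => i; exact: prim_expr_mod. Qed.

Let Y0E j : Y0 (u ^+ j) = (zeta ^+ d) ^+ j *: u ^+ j.
Proof. by rewrite shift_opE ?addn0. Qed.

Let x0_mod i : gamma * qnat q (i %% n) = gamma * qnat q i.
Proof. by rewrite qnat_modn. Qed.

Let X0_mod i : delta * qnat p (i %% n) = delta * qnat p i.
Proof. by rewrite qnat_modn. Qed.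

Let x0E j : x0 (u ^+ j) = (gamma * qnat q j) *: u ^+ (j + t).
Proof. exact: shift_opE. Qed.

Let X0E j : X0 (u ^+ j) = (delta * qnat p j) *: u ^+ (j + (n - t)).
Proof. exact: shift_opE. Qed.

Let eigen_opX (g : E) c r j : g (u ^+ j) = c *: u ^+ j ->
  (g ^+ r) (u ^+ j) = c ^+ r *: u ^+ j.
Proof.
move=> gu; elim: r => [|r IH]; first by rewrite !expr0 endo1E scale1r.
by rewrite !exprSr endoME gu linearZ /= IH scalerA mulrC.
Qed.

Lemma shift_op_double_relations :
  D_relations zeta n m t N ([:: y0; Y0; x0; X0] : seq E).
Proof.
have t_le := t_le_n n_gt0 t_dvd_n.
have zn := prim_expr_order zeta_prim.
have z_neq0 := zeta_neq0 n_gt0 zeta_prim.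
have z_subt : zeta ^+ (n - t) = zeta ^- t.
  have zt_neq0 : zeta ^+ t != 0 by rewrite expf_neq0.
  by apply: (mulIf zt_neq0); rewrite mulVf // -exprD subnK.
have zd_subt : (zeta ^+ d) ^+ (n - t) = q.
  have p_neq0 : p != 0 by rewrite expf_neq0.
  apply: (mulIf p_neq0); rewrite [RHS]mulrC pq exprM -exprD subnK //.
  exact: q_expn.
have pE : p = zeta ^- m.
  have q_neq0 : q != 0 by rewrite expf_neq0.
  by apply: (mulIf q_neq0); rewrite mulVf.
split.
- split.
  + apply: endo_cyclic_ext => j; rewrite (eigen_opX n (y0E j)).
    by rewrite exprAC zn expr1n scale1r endo1E.
  + apply: endo_cyclic_ext => j; rewrite (eigen_opX n (Y0E j)).
    by rewrite [(_ ^+ j) ^+ n]exprAC (q_expn d zeta_prim) expr1n scale1r endo1E.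
  + apply: shift_op_nilp => // j; have [i i_lt Ei] := orbit j; exists i => //.
    by apply/eqP; rewrite mulf_eq0 qnat_eq0 // Ei eqxx orbT.
  (* The witness for [X0] at [j] is that for [x0] at [-j], written [(n - 1) j]: the exponents
     [j + i (n - t)] and [(n - 1) j + i t] add up to a multiple of [n]. *)
  + apply: shift_op_nilp => // j; have [i i_lt Ei] := orbit (n.-1 * j)%N.
    exists i => //; apply/eqP; rewrite mulf_eq0 qnat_eq0 //; apply/orP; right.
    have qa : q ^+ (j + i * (n - t)) = 1.
      rewrite -[LHS]mulr1 -[X in _ * X]Ei -exprD addnACA -mulnDr subnK //.
      by rewrite -mulSn prednK // mulnC -mulnDl mulnC exprM qn expr1n.
    by rewrite -[p ^+ _]mulr1 -[X in _ * X]qa -exprMn pq expr1n.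
- split; apply: endo_cyclic_ext => j; rewrite scale_lfunE !endoME.
  + rewrite x0E y0E !linearZ /= y0E x0E !scalerA; congr (_ *: _).
    by rewrite exprD; ring.
  + rewrite X0E Y0E !linearZ /= Y0E X0E !scalerA; congr (_ *: _).
    by rewrite exprD zd_subt; ring.
- split.
  + apply: endo_cyclic_ext => j; rewrite !endoME Y0E y0E !linearZ /= Y0E y0E.
    by rewrite !scalerA mulrC.
  + apply: endo_cyclic_ext => j; rewrite scale_lfunE !endoME.
    rewrite x0E Y0E !linearZ /= Y0E x0E !scalerA; congr (_ *: _).
    rewrite exprD -[(_ ^+ d) ^+ t]exprM.
    by rewrite -[LHS]mul1r -pq; ring.
  + apply: endo_cyclic_ext => j; rewrite scale_lfunE !endoME.
    rewrite X0E y0E !linearZ /= y0E X0E !scalerA; congr (_ *: _).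
    by rewrite exprD z_subt; ring.
- apply: endo_cyclic_ext => j; rewrite !add_lfunE !opp_lfunE !endoME.
  rewrite (shift_commutator n_gt0 t_le x0E X0E).
  rewrite (eigen_opX t (Y0E j)) (eigen_opX m (y0E j)) -scalerBl.
  congr (_ *: _); rewrite [(_ ^+ j) ^+ t]exprAC -[(_ ^+ d) ^+ t]exprM.
  rewrite [(_ ^+ j) ^+ m]exprAC.
  have pm1 : p - 1 != 0 by rewrite subr_eq0.
  (* What remains carries the factor [p ^+ j - q ^+ j] on both sides: it vanishes for [m = n/2],
     where [p = q], and otherwise [gamma_delta] matches the other factors. *)
  apply: (mulfI pm1); rewrite mulrCA (qnat_commutator j pq q1 qn t_le).
  have [m2|/eqP m2] := eqVneq m.*2 n.
    suff -> : p = q by rewrite subrr mul0r !mulr0.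
    have qq : q * q = 1 by rewrite -expr2 -exprM muln2 m2 zn.
    by apply: (mulIf (expf_neq0 m z_neq0)); rewrite pq qq.
  rewrite (gamma_delta m2) mulrCA divfK ?qnat_subn_neq0 // -pE.
  by rewrite mulrC.
Qed.
(** The universal property turns the operators into an action. On monomials, the product rule for
    [x] is [(i+j)_q = (i)_q + q^i (j)_q]. *)
Lemma double_module_algebra : exists act,
  module_algebra act /\ action_formulas zeta t d gamma delta y Y x X act.
Proof.
have [f [fy fY fx fX]] :=
  presented_univ (D_presented presD) shift_op_double_relations.
pose b h (a : A) : A := (f h : E) a.
have b_bilinear : bilinear_for *:%R *:%R b.
  split=> [a|h] c v w; rewrite /b ?linearP //.
  by rewrite add_lfunE scale_lfunE.
have [act actE] : exists act : {bilinear D -> A -> A},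
    forall h a, act h a = (f h : E) a.
  pose act : {bilinear D -> A -> A} :=
    HB.pack b (bilinear_isBilinear.Build k D A A _ _ b b_bilinear).
  by exists act.
have [y_gl Y_gl] := (D_grouplike_y presD, D_grouplike_Y presD).
have act1 a : act 1 a = a by rewrite actE rmorph1 endo1E.
have actM g h a : act (g * h) a = act g (act h a).
  by rewrite !actE rmorphM endoME.
have yE j : act y (u ^+ j) = zeta ^+ j *: u ^+ j by rewrite actE fy y0E.
have YE j : act Y (u ^+ j) = (zeta ^+ d) ^+ j *: u ^+ j.
  by rewrite actE fY Y0E.
have xE j : act x (u ^+ j) = (gamma * qnat q j) *: u ^+ (j + t).
  by rewrite actE fx x0E.
have XE j : act X (u ^+ j) = (delta * qnat p j) *: u ^+ (j + (n - t)).
  by rewrite actE fX X0E.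
have ymE j : act (y ^+ m) (u ^+ j) = q ^+ j *: u ^+ j.
  by rewrite actE rmorphXn /= fy (eigen_opX m (y0E j)) exprAC.
have YtE j : act (Y ^+ t) (u ^+ j) = p ^+ j *: u ^+ j.
  rewrite actE rmorphXn /= fY (eigen_opX t (Y0E j)) [(_ ^+ j) ^+ t]exprAC.
  by rewrite -[(_ ^+ d) ^+ t]exprM.
have t_le := t_le_n n_gt0 t_dvd_n.
exists act; split; last first.
  have qnat1 c : qnat c 1 = 1 by rewrite qnatS qnat0 mulr0 add0r.
  split.
  - by have := yE 1%N; rewrite !expr1.
  - by have := YE 1%N; rewrite !expr1.
  - by have := xE 1%N; rewrite !expr1 qnat1 mulr1.
  - by have := XE 1%N; rewrite !expr1 qnat1 mulr1 addnBA // [(1 + n)%N]addnC.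
apply: (module_algebra_gen (presented_gen (D_presented presD))) => // g.
  rewrite !inE => /or4P[]/eqP -> a b'.
  - apply: (mact_mul_cyclic n_gt0 (proj2 y_gl)) => i j.
    by rewrite big_seq1 /= -exprD !yE -scalerAl -scalerAr scalerA -!exprD.
  - apply: (mact_mul_cyclic n_gt0 (proj2 Y_gl)) => i j.
    by rewrite big_seq1 /= -exprD !YE -scalerAl -scalerAr scalerA -!exprD.
  - apply: (mact_mul_cyclic n_gt0 (D_skew_x presD)) => i j.
    rewrite big_cons big_seq1 /= -exprD ymE act1 !xE -!scalerAl -scalerAr.
    rewrite scalerA -!exprD addnAC [(i + (j + t))%N]addnA [(i + j + t)%N]addnAC.
    by rewrite -scalerDl qnatD; congr (_ *: _); ring.
  - apply: (mact_mul_cyclic n_gt0 (D_skew_X presD)) => i j.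
    rewrite big_cons big_seq1 /= -exprD YtE act1 !XE -!scalerAl -!scalerAr.
    rewrite scalerA -!exprD addnAC [(i + (j + _))%N]addnA [(i + j + _)%N]addnAC.
    (* For [X] the grouplike acts on the second factor, so the exponents are added as [j + i]. *)
    by rewrite -scalerDl addnC qnatD; congr (_ *: _); ring.
rewrite !inE => /or4P[]/eqP ->.
- by have := yE 0%N; rewrite !expr0 counit_grouplike.
- by have := YE 0%N; rewrite !expr0 counit_grouplike.
- have := xE 0%N; rewrite expr0 qnat0 mulr0 !scale0r => ->.
  rewrite (counit_skew_primitive _ _ (D_skew_x presD)) ?scale0r ?rmorph1 //.
  exact/counit_grouplike/grouplikeX.
- have := XE 0%N; rewrite expr0 qnat0 mulr0 !scale0r => ->.
  rewrite (counit_skew_primitive _ _ (D_skew_X presD)) ?scale0r ?rmorph1 //.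
  exact/counit_grouplike/grouplikeX.
Qed.

End Construction.

End DoubleAction.

(** * Classification of the extensions to the double *)

Theorem theorem4p19 (k : closedFieldType) (char0 : [pchar k] =i pred0)
    (n m t : nat) (zeta : k)
    (n_gt0 : (0 < n)%N) (m_dvd_n : (m %| n)%N) (t_dvd_n : (t %| n)%N)
    (n_ndvd_mt : ~~ (n %| m * t)%N)
    (zeta_prim : n.-primitive_root zeta)
    (N : nat) (N_ord : N.-primitive_root (zeta ^+ (m * t)))
    (H : hopfAlgType k) (y x : H) (presH : is_gen_taft zeta n m t N y x)
    (D : hopfAlgType k) (yD YD xD XD : D)
    (presD : is_double zeta n m t N yD YD xD XD)
    (iota : {lrmorphism H -> D}) (iota_y : iota y = yD) (iota_x : iota x = xD)
    (act : {bilinear H -> cyclic_alg k n -> cyclic_alg k n})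
    (act_module : module_algebra act) (act_faithful : inner_faithful act)
    (act_y : act y (cyclic_gen k n) = zeta *: cyclic_gen k n) :
  [/\ forall actD, extends_action iota act actD ->
        exists (gamma delta : k) (d : nat),
          [/\ gamma != 0,
              (0 < d < n)%N,
              (m = - (d * t)%N%:Z %[mod n])%Z,
              action_formulas zeta t d gamma delta yD YD xD XD actD
            & m.*2 <> n ->
              gamma * delta = (zeta ^- m - 1) / qnat (zeta ^+ m) (n - t)],
      m.*2 <> n -> forall actD actD',
        extends_action iota act actD -> extends_action iota act actD' ->
        (forall a, actD XD a = actD' XD a) /\
        (t = 1%N -> forall a, actD YD a = actD' YD a),
      m.*2 = n -> forall actD, extends_action iota act actD ->
        forall delta : k, exists actD',
          [/\ extends_action iota act actD',
              forall a, actD' YD a = actD YD a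
            & actD' XD (cyclic_gen k n) =
                delta *: cyclic_gen k n ^+ (n + 1 - t)]
    & forall (gamma delta : k) (d : nat),
        act x (cyclic_gen k n) = gamma *: cyclic_gen k n ^+ (1 + t) ->
        (0 < d < n)%N ->
        (m = - (d * t)%N%:Z %[mod n])%Z ->
        (m.*2 <> n ->
           gamma * delta = (zeta ^- m - 1) / qnat (zeta ^+ m) (n - t)) ->
        exists actD,
          [/\ extends_action iota act actD,
              action_formulas zeta t d gamma delta yD YD xD XD actD
            & forall actD', module_algebra actD' ->
                action_formulas zeta t d gamma delta yD YD xD XD actD' ->
                forall h a, actD' h a = actD h a]].
Proof.
have [gamma0 gamma0_neq0 xu] := taft_action n_gt0 t_dvd_n n_ndvd_mt zeta_prim
  N_ord presH act_module act_faithful act_y.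
have orbit := taft_orbit n_gt0 t_dvd_n n_ndvd_mt zeta_prim N_ord presH
  act_module act_faithful act_y.
have powers := action_formulas_powers n_gt0 t_dvd_n presD.
(* Every extension has the same [gamma0], since [xD] acts as [x] does. *)
have classify actD : extends_action iota act actD -> exists delta d,
    [/\ (0 < d < n)%N, zeta ^+ (d * t) * zeta ^+ m = 1
      & action_formulas zeta t d gamma0 delta yD YD xD XD actD].
  case=> actD_mod ext.
  by apply: (double_action_formulas n_gt0 t_dvd_n n_ndvd_mt zeta_prim presD);
    rewrite // -?iota_y -?iota_x ext.
have relation (actD : {bilinear D -> cyclic_alg k n -> cyclic_alg k n})
    delta d : module_algebra actD ->
    action_formulas zeta t d gamma0 delta yD YD xD XD actD ->
    zeta ^+ (d * t) * zeta ^+ m = 1 -> m.*2 <> n ->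
    gamma0 * delta = (zeta ^- m - 1) / qnat (zeta ^+ m) (n - t).
  exact: (action_formulas_relation n_gt0 m_dvd_n t_dvd_n n_ndvd_mt
    zeta_prim presD).
have construct gamma delta d : act x (cyclic_gen k n) =
      gamma *: cyclic_gen k n ^+ (1 + t) ->
    zeta ^+ (d * t) * zeta ^+ m = 1 ->
    (m.*2 <> n -> gamma * delta = (zeta ^- m - 1) / qnat (zeta ^+ m) (n - t)) ->
    exists2 actD, extends_action iota act actD &
      action_formulas zeta t d gamma delta yD YD xD XD actD.
  move=> xu' pq gd.
  have [actD [actD_mod formulas]] := double_module_algebra n_gt0 t_dvd_n
    n_ndvd_mt zeta_prim presD pq gd orbit.
  exists actD => //; split=> //.
  apply: (module_algebra_ext (presented_gen (H_presented presH))) => // g.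
  rewrite !inE => /orP[]/eqP -> a; apply: (cyclic_linear_ext n_gt0) => j /=.
    rewrite iota_y (mact_eigen act_module j (H_grouplike_y presH) act_y).
    by case: (powers _ _ _ _ actD_mod formulas j).
  have y_gl := H_grouplike_y presH.
  rewrite iota_x (mact_skew_left act_module j (grouplikeX m y_gl)
    (H_skew_x presH) (mact_expr_eigen act_module m act_y) xu').
  by case: (powers _ _ _ _ actD_mod formulas j).
split.
- move=> actD ext; have [delta [d [d_bd pq formulas]]] := classify actD ext.
  exists gamma0, delta, d; split=> //; first exact/(congr_exp m t zeta_prim).
  exact: relation (proj1 ext) formulas pq.
- move=> m2 actD actD' ext ext'.
  have [delta [d [d_bd pq formulas]]] := classify actD ext.
  have [delta' [d' [d'_bd pq' formulas']]] := classify actD' ext'.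
  have E := powers _ _ _ _ (proj1 ext) formulas.
  have E' := powers _ _ _ _ (proj1 ext') formulas'.
  have q_neq0 : zeta ^+ m != 0.
    by rewrite expf_neq0 // (zeta_neq0 n_gt0 zeta_prim).
  (* [d] and [d'] may differ, but both powers invert [q], so the q-integers in the action of [X]
     agree. *)
  have p_eq : zeta ^+ (d * t) = zeta ^+ (d' * t).
    by apply: (mulIf q_neq0); rewrite pq pq'.
  have delta_eq : delta = delta'.
    apply: (mulfI gamma0_neq0).
    rewrite (relation _ _ _ (proj1 ext) formulas pq m2).
    by rewrite (relation _ _ _ (proj1 ext') formulas' pq' m2).
  split=> [a|t1 a]; apply: (cyclic_linear_ext n_gt0) => j /=.
    by case: (E j) => _ _ _ ->; case: (E' j) => _ _ _ ->; rewrite p_eq delta_eq.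
  case: (E j) => _ -> _ _; case: (E' j) => _ -> _ _; congr (_ ^+ _ *: _).
  (* For [t = 1] the equality [p_eq] is that of the eigenvalues of [Y] on [u]. *)
  by move: p_eq; rewrite t1 !muln1.
- move=> m2 actD ext delta.
  have [delta0 [d [d_bd pq formulas]]] := classify actD ext.
  (* Reusing [d] keeps the action of [Y]; any [delta] is admissible as [m = n/2]. *)
  have [//|actD' ext' formulas'] := construct gamma0 delta d xu pq.
  exists actD'; split=> //; last by case: formulas'.
  move=> a; apply: (cyclic_linear_ext n_gt0) => j /=.
  case: (powers _ _ _ _ (proj1 ext) formulas j) => _ -> _ _.
  by case: (powers _ _ _ _ (proj1 ext') formulas' j) => _ -> _ _.
- move=> gamma delta d xu' d_bd /(congr_exp m t zeta_prim) pq gd.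
  have [actD ext formulas] := construct gamma delta d xu' pq gd.
  exists actD; split=> // actD' actD'_mod.
  exact: (action_formulas_ext n_gt0 t_dvd_n presD (proj1 ext)).
Qed.
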